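(* Let $d\in\mathbb{N}$, let $\varphi\in\mathcal{A}_d$ be increasing and let $\mathcal{L}\subset(0,1)$ be an arbitrary countable set. Then for any $\varepsilon>0$, there exists $F\subset\mathbb{R}^d$ such that the function $f(\theta)=\dim_{\mathrm{A}}^{\theta}F$, $\theta\in(0,1)$, satisfies $\lVert f-\varphi\rVert_\infty\leq\varepsilon$ and, for all $\lambda\in\mathcal{L}$, $D^{-}f(\lambda)>0$ and $D^{+}f(\lambda)<0$.
   Context: For $d\in\mathbb{N}$, $\mathcal{A}_d$ denotes the set of functions $\varphi\colon(0,1)\to[0,d]$ such that for all $0<\lambda<\theta<1$, $$0\leq (1-\lambda)\varphi(\lambda)-(1-\theta)\varphi(\theta)\leq(\theta-\lambda)\,\varphi\Bigl(\frac{\lambda}{\theta}\Bigr).$$ ''Increasing'' is meant in the non-strict sense; $\lVert\cdot\rVert_\infty$ is the supremum norm over $(0,1)$. The upper right and upper left Dini derivatives are $$D^{+}f(x)=\limsup_{\varepsilon\searrow 0}\frac{f(x+\varepsilon)-f(x)}{\varepsilon},\qquad D^{-}f(x)=\limsup_{\varepsilon\searrow 0}\frac{f(x)-f(x-\varepsilon)}{\varepsilon}.$$ $\mathbb{R}^d$ carries the Euclidean norm and $B(x,\delta)$ is the open ball of centre $x$ and radius $\delta$. For bounded $E\subset\mathbb{R}^d$ and $\delta>0$, $N_\delta(E)$ is the least number of balls of radius $\delta$ required to cover $E$. For $\theta\in(0,1)$ the Assouad spectrum of $F\subset\mathbb{R}^d$ is $$\dim_{\mathrm{A}}^{\theta}F=\inf\Bigl\{\alpha:(\exists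 C>0)(\forall\, 0<\delta\leq 1)(\forall x\in F)\ N_{\delta^{1/\theta}}(F\cap B(x,\delta))\leq C\Bigl(\frac{\delta}{\delta^{1/\theta}}\Bigr)^{\alpha}\Bigr\}.$$ *)

(* Defs.v *)
From HB Require Import structures.
From mathcomp Require Import all_boot all_order all_algebra.
From mathcomp Require Import all_classical all_reals all_analysis.

Set Implicit Arguments.
Unset Strict Implicit.
Unset Printing Implicit Defensive.

Import Order.TTheory GRing.Theory Num.Theory.
Import numFieldNormedType.Exports.

Local Open Scope classical_set_scope.
Local Open Scope ring_scope.

(* Functions on (0,1) are represented by total functions [R -> R]; every notion
   below only depends on the values taken on (0,1). *)

Definition class_A (R : realType) (d : nat) (phi : R -> R) : Prop :=
  (forall theta, 0 < theta < 1 -> 0 <= phi theta <= d%:R) /\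
  (forall lambda theta, 0 < lambda -> lambda < theta -> theta < 1 ->
     0 <= (1 - lambda) * phi lambda - (1 - theta) * phi theta
       <= (theta - lambda) * phi (lambda / theta)).

Definition increasing01 (R : realType) (phi : R -> R) : Prop :=
  {in `]0, 1[ &, {homo phi : x y / x <= y}}.

(* Extended-real valued, so that an unbounded function has norm +oo. *)
Definition supnorm01 (R : realType) (g : R -> R) : \bar R :=
  ereal_sup [set `|g theta|%:E | theta in `]0, 1[%classic].

Definition dini_upper_right (R : realType) (f : R -> R) (x : R) : \bar R :=
  limf_esup (fun e : R => ((f (x + e) - f x) / e)%:E) 0^'+.

Definition dini_upper_left (R : realType) (f : R -> R) (x : R) : \bar R :=
  limf_esup (fun e : R => ((f x - f (x - e)) / e)%:E) 0^'+.

(* The norm of the library on ['rV[R]_d] is the maximum norm, hence a separate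
   Euclidean norm. *)
Definition enorm (R : realType) (d : nat) (x : 'rV[R]_d) : R :=
  Num.sqrt (\sum_(i < d) x 0 i ^+ 2).

Definition eball (R : realType) (d : nat) (x : 'rV[R]_d) (delta : R)
    : set 'rV[R]_d :=
  [set y | enorm (y - x) < delta].

(* Centres may be any points of R^d; the value is +oo when no finite cover
   exists, which does not happen for bounded [E]. *)
Definition covering_number (R : realType) (d : nat) (delta : R)
    (E : set 'rV[R]_d) : \bar R :=
  ereal_inf [set n%:R%:E | n in [set n : nat |
    exists c : 'I_n -> 'rV[R]_d, E `<=` \bigcup_i eball (c i) delta]].

(* The infimum is over real [alpha], so it is -oo for empty [F]. *)
Definition assouad_spectrum (R : realType) (d : nat) (F : set 'rV[R]_d)
    (theta : R) : \bar R :=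
  ereal_inf [set alpha%:E | alpha in [set alpha : R |
    exists2 C : R, 0 < C &
      forall (delta : R) (x : 'rV[R]_d), 0 < delta <= 1 -> F x ->
        (covering_number (delta `^ theta^-1)%R (F `&` eball x delta)
           <= (C * (delta / delta `^ theta^-1) `^ alpha)%R%:E)%E]].

(* Main.v *)
Require Import Defs.
From mathcomp Require Import all_boot all_order all_algebra.
From mathcomp Require Import all_classical all_reals all_analysis.
From mathcomp Require Import zify ring lra.

(** Two ingredients.

    Realization.  For [phi] of class A put [psi x = (1 - x) phi x] on [(0, 1)]
    and [psi x = 0] for [1 <= x].  The two inequalities defining the class say
    that [psi] is decreasing, is [d]-Lipschitz, and satisfies
    [psi x - psi (x / theta) <= (x / theta - x) phi theta].  Let [F_n] be the
    set of points of [[0, 1)^d] whose coordinates have [n] binary digits, the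
    number of free ones among the digits [i + 1, ..., j] being
    [n (psi (i / n) - psi (j / n)) / d] up to a bounded error.  Covering a ball
    of radius [2 ^ -t] by balls of radius [2 ^ -(t / theta)] then takes about
    [2 ^ (n psi (t / n) - n psi (t / (n theta)))] of them, which is at most
    [(2 ^ (t / theta - t)) ^ (phi theta)], with equality for [t = theta n].
    Far apart translates of the [F_n] make up a set with spectrum [phi].

    Perturbation.  Let [lam] enumerate a countable set containing [L], choose
    tiny intervals [I_m] around the [lam m], let [v] be the length function of
    their union [U], and let [h] have derivative [+1] or [-1] on [U], according
    to whether the last [I_m] that contains the point contains it in its left
    or in its right half, and [0] elsewhere.  Since [I_m] is tiny compared with
    the distance of [lam m] to the previous centres, [h] has a spike of slopes
    almost [+1] and [-1] at each [lam n].  Composing [phi] with [x - v x] makes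
    it flat on [U], so that a small multiple of [h] is enough to create a strict
    spike; for increasing [phi] the second inequality of class A says that
    [phi x] is at most a weighted mean of two values of [phi] at larger points,
    and adding [kappa x] leaves room in it for [5 / 4 kappa h]. *)

Set Implicit Arguments.
Unset Strict Implicit.
Unset Printing Implicit Defensive.

Import Order.TTheory GRing.Theory Num.Theory.
Import numFieldNormedType.Exports.

Local Open Scope classical_set_scope.
Local Open Scope ring_scope.

(** * Binary codes with a prescribed number of free digits *)

Section BinaryCodes.
Local Open Scope nat_scope.
Variable g : nat -> nat.

(* [p] encodes the first [i] digits; digit [j] is free when [g] drops between
   [j - 1] and [j], and is [0] otherwise. *)
Fixpoint codes (i k p : nat) : seq nat :=
  if k is k'.+1 then
    flatten [seq (if g (i + k) < g (i + k') then [:: q.*2; q.*2.+1]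
                  else [:: q.*2]) | q <- codes i k' p]
  else [:: p].

Hypothesis g_step : forall j, g j.+1 <= g j <= (g j.+1).+1.

(** A free digit doubles the list while [g] drops by one, and any other digit changes neither, so
    the product is invariant. *)
Lemma size_codes i k p : size (codes i k p) * 2 ^ g (i + k) = 2 ^ g i.
Proof.
elim: k => [|k IH]; first by rewrite addn0 mul1n.
rewrite -[RHS]IH /= size_flatten /shape -map_comp.
have := g_step (i + k); rewrite -addnS => /andP[h1 h2].
case: ltnP => h3.
- rewrite (eq_map (g := fun=> 2)) //.
  have -> : g (i + k) = (g (i + k.+1)).+1 by lia.
  rewrite expnS mulnA; congr (_ * _).
  by elim: (codes i k p) => //= _ s ->; lia.
- rewrite (eq_map (g := fun=> 1)) //.
  have -> : g (i + k) = g (i + k.+1) by lia.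
  congr (_ * _).
  by elim: (codes i k p) => //= _ s ->; lia.
Qed.

Lemma codes_half i k p z : z \in codes i k.+1 p -> z./2 \in codes i k p.
Proof.
move=> /= /flattenP[s /mapP[q hq ->]] hz; suff -> : z./2 = q by [].
by move: hz; case: ifP => _; rewrite !inE; lia.
Qed.

Lemma codes_div i k p z : z \in codes i k p -> z %/ 2 ^ k = p.
Proof.
elim: k z => [|k IH] z; first by rewrite mem_seq1 divn1 => /eqP.
by move=> /codes_half /IH; rewrite expnS divnMA divn2.
Qed.

Lemma codes_prefix i k l p z : z \in codes i (k + l) p ->
  z %/ 2 ^ l \in codes i k p.
Proof.
elim: l z => [|l IH] z; first by rewrite addn0 divn1.
by rewrite addnS => /codes_half /IH; rewrite expnS divnMA divn2.
Qed.

(** Whether a digit is free depends on its position alone, so the last [l] digits are constrained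
    independently of the first ones. *)
Lemma codes_suffix i k l p z : z \in codes i (k + l) p ->
  z \in codes (i + k) l (z %/ 2 ^ l).
Proof.
elim: l z => [|l IH] z; first by rewrite /= divn1 mem_seq1.
rewrite addnS /= => /flattenP[s /mapP[q hq ->] hz].
apply/flattenP; rewrite -addnA addnS.
eexists; last exact: hz.
apply/mapP; exists q; last by rewrite -addnA.
suff -> : z %/ 2 ^ l.+1 = q %/ 2 ^ l by apply: IH.
rewrite expnS divnMA divn2; congr (_ %/ _); move: hz.
by case: ifP => _; rewrite !inE; lia.
Qed.

Lemma codes_cat i k l p q z : q \in codes i k p -> z \in codes (i + k) l q ->
  z \in codes i (k + l) p.
Proof.
move=> hq; elim: l z => [|l IH] z.
  by rewrite addn0 /= mem_seq1 => /eqP ->.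
rewrite addnS /= => /flattenP[s /mapP[u hu ->] hz].
apply/flattenP; eexists; last exact: hz.
apply/mapP; exists u; last by rewrite -addnA addnS addnA.
exact: IH.
Qed.

Lemma codes0 i k : 0 \in codes i k 0.
Proof.
elim: k => [|k IH] //=; apply/flattenP.
exists (if g (i + k.+1) < g (i + k) then [:: 0.*2; 0.*2.+1] else [:: 0.*2]).
  by apply/mapP; exists 0.
by case: ifP.
Qed.

Lemma codes_uniq i k p : uniq (codes i k p).
Proof.
elim: k => [|k IH] //=.
case: (g _ < g _); elim: (codes i k p) IH => //= q s IHs /andP[hq /IHs hs].
- rewrite hs !inE andbT; apply/andP; split.
  + by rewrite negb_or; apply/andP; split; first lia;
    apply/negP => /flattenP[u /mapP[v hv ->]]; rewrite !inE => hz;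
    move/negP: hq; apply; suff -> : q = v by []; lia.
  + by apply/negP => /flattenP[u /mapP[v hv ->]]; rewrite !inE => hz;
    move/negP: hq; apply; suff -> : q = v by []; lia.
- rewrite hs andbT; apply/negP => /flattenP[u /mapP[v hv ->]]; rewrite !inE => hz.
  by move/negP: hq; apply; suff -> : q = v by []; lia.
Qed.

End BinaryCodes.

(** * Digit profiles attached to a function of class A *)

Section Profile.
Variables (R : realType) (d : nat) (phi : R -> R).

Definition profile (x : R) : R := if x < 1 then (1 - x) * phi x else 0.

Hypothesis phiA : class_A d phi.

Lemma profile_step x y : 0 < x -> x <= y ->
  0 <= profile x - profile y <= d%:R * (y - x).
Proof.
case: phiA => phi_bd phi_ineq x0; rewrite le_eqVlt => /predU1P[->|xy].
  by rewrite !subrr mulr0 lexx.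
have d0 : 0 <= d%:R :> R by [].
rewrite /profile; case: ltP => x1; case: ltP => y1; try lra.
- have /andP[-> h2] := phi_ineq x y x0 xy y1.
  apply: le_trans h2 _; rewrite mulrC ler_wpM2r //; first by rewrite subr_ge0 ltW.
  have y0 : 0 < y by lra.
  have /phi_bd/andP[_ //] : 0 < x / y < 1.
  by rewrite divr_gt0 //= ltr_pdivrMr // mul1r.
- have /phi_bd/andP[h1 h2] : 0 < x < 1 by rewrite x0.
  have x1' : 0 <= 1 - x by rewrite subr_ge0 ltW.
  rewrite subr0 mulr_ge0 //=.
  apply: (@le_trans _ _ ((1 - x) * d%:R)); first by rewrite ler_wpM2l.
  by rewrite mulrC ler_wpM2l // lerD2r.
- rewrite subrr lexx mulr_ge0 // subr_ge0; exact: ltW.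
Qed.

Lemma profile_ge0 x : 0 < x -> 0 <= profile x.
Proof.
rewrite /profile => x0; case: ltP => // x1.
have /phiA.1/andP[phi0 _] : 0 < x < 1 by rewrite x0.
by rewrite mulr_ge0 // subr_ge0 ltW.
Qed.

(** One-sided form that absorbs rounding: [y] may lie on either side of [x], monotonicity settling
    the case [y < x]. *)
Lemma profile_lip x y e : 0 < x -> 0 < y -> 0 <= e -> y <= x + e ->
  profile x <= profile y + d%:R * e.
Proof.
move=> x0 y0 e0 yx; have d0 : 0 <= d%:R :> R by [].
have [xy|xy] := leP x y.
  have /andP[_ h] := profile_step x0 xy.
  have : d%:R * (y - x) <= d%:R * e by rewrite ler_wpM2l // lerBlDl.
  lra.
have /andP[h _] := profile_step y0 (ltW xy).
have : 0 <= d%:R * e by rewrite mulr_ge0.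
lra.
Qed.

Lemma profile_scale x theta : 0 < x -> 0 < theta < 1 ->
  profile x <= profile (x / theta) + (x / theta - x) * phi theta.
Proof.
move=> x0 /andP[t0 t1].
have phi0 : 0 <= phi theta by have /phiA.1/andP[] : 0 < theta < 1 by rewrite t0.
have xt : x < x / theta by rewrite ltr_pdivlMr // gtr_pMr.
rewrite {2}/profile; case: ltP => h.
- have x1 : x < 1 by lra.
  have := phiA.2 x (x / theta) x0 xt h.
  rewrite /profile x1 invf_div mulrCA divff ?gt_eqF// mulr1; lra.
(* Here [theta <= x], so [profile x] is at most [(1 - theta) phi theta], and [x / theta - x] is at
   least [1 - theta]. *)
- rewrite ler_pdivlMr // mul1r in h.
  have /andP[k _] := profile_step t0 h; rewrite add0r.
  apply: (@le_trans _ _ (profile theta)); first lra.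
  rewrite /profile t1 ler_wpM2r //.
  have -> : x / theta - x = (1 - theta) * (x / theta) by field; rewrite gt_eqF.
  by rewrite ler_peMr ?subr_ge0 ?(ltW t1) // ler_pdivlMr // mul1r.
Qed.

(* [maxn j 1] because [profile 0] would involve the junk value [phi 0]. *)
Definition level (n j : nat) : nat :=
  Num.truncn (n%:R * profile ((maxn j 1)%:R / n%:R) / d%:R).

Hypothesis d_gt0 : (0 < d)%N.
Variable n : nat.
Hypothesis n_gt0 : (0 < n)%N.

Let dR : 0 < d%:R :> R. Proof. by rewrite ltr0n. Qed.
Let nR : 0 < n%:R :> R. Proof. by rewrite ltr0n. Qed.

Let pos j : 0 < (maxn j 1)%:R / n%:R :> R.
Proof. by rewrite divr_gt0 // ltr0n leq_max orbT. Qed.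

Let level_arg j : 0 <= n%:R * profile ((maxn j 1)%:R / n%:R) / d%:R.
Proof. by rewrite divr_ge0 // mulr_ge0 // profile_ge0. Qed.

Lemma level_le j : d%:R * (level n j)%:R <= n%:R * profile ((maxn j 1)%:R / n%:R).
Proof. by rewrite mulrC -ler_pdivlMr // truncn_le. Qed.

Lemma level_ge j :
  n%:R * profile ((maxn j 1)%:R / n%:R) <= d%:R * (level n j).+1%:R.
Proof.
by rewrite [leRHS]mulrC -ler_pdivrMr //; have /andP[_ /ltW] := truncn_itv (level_arg j).
Qed.

(** Division by [d] turns the Lipschitz constant [d] into increments of at most 1, so one binary
    digit per position is enough. *)
Lemma level_step j : (level n j.+1 <= level n j <= (level n j.+1).+1)%N.
Proof.
have le_pos : (maxn j 1)%:R / n%:R <= (maxn j.+1 1)%:R / n%:R :> R.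
  by rewrite ler_pM2r ?invr_gt0 // ler_nat; lia.
have /andP[h1 h2] := profile_step (pos j) le_pos.
apply/andP; split.
  apply: le_truncn; rewrite ler_pM2r ?invr_gt0 // ler_pM2l //; lra.
have h3 : n%:R * profile ((maxn j 1)%:R / n%:R) / d%:R <=
     n%:R * profile ((maxn j.+1 1)%:R / n%:R) / d%:R + 1.
  rewrite -[X in _ + X](divff (lt0r_neq0 dR)) -mulrDl ler_pM2r ?invr_gt0 //.
  rewrite -lerBlDl -mulrBr mulrC -ler_pdivlMr //.
  apply: le_trans h2 _; rewrite ler_pM2l // -mulrBl -[leRHS]mul1r ler_pM2r ?invr_gt0 //.
  by rewrite lerBlDl natr1 ler_nat; lia.
rewrite -ltnS truncn_lt_nat //; apply: le_lt_trans h3 _.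
by rewrite -natr1 ltrD2r; have /andP[] := truncn_itv (level_arg j.+1).
Qed.

Lemma level_last : level n n = 0%N.
Proof.
rewrite /level (_ : maxn n 1 = n); last by lia.
by rewrite /profile divff ?gt_eqF // ltxx mulr0 mul0r truncn0.
Qed.

(** The error [d (d + 3)] is [d] for rounding [t] down, [d (d + 1)] for the shift in [j], and [d]
    for the truncation in [level]. *)
Lemma level_drop_upper (t theta : R) : 0 < t -> 0 < theta < 1 ->
  let i := minn (Num.truncn t) n in
  let j := minn (Num.truncn (t / theta) + d.+1) n in
  d%:R * (level n i)%:R <=
    d%:R * (level n j)%:R + (t / theta - t) * phi theta + d%:R * d.+3%:R.
Proof.
move=> t0 th /=; set i := minn _ n; set j := minn _ n.
have th0 : 0 < theta by case/andP: th.
have tth : 0 < t / theta by rewrite divr_gt0.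
have hi : n%:R * profile ((maxn i 1)%:R / n%:R) <= n%:R * profile (t / n%:R) + d%:R.
  have -> : n%:R * profile (t / n%:R) + d%:R
     = n%:R * (profile (t / n%:R) + d%:R * n%:R^-1).
    by field; rewrite gt_eqF.
  rewrite ler_pM2l //; have [nt|nt] := leqP n (Num.truncn t).
    rewrite {1}/profile (_ : maxn i 1 = n); last by rewrite /i; lia.
    rewrite divff ?gt_eqF // ltxx addr_ge0 ?profile_ge0 ?divr_gt0 //.
  apply: profile_lip => //; first by rewrite divr_gt0.
  rewrite -[X in _ <= _ + X]mul1r -mulrDl ler_pM2r ?invr_gt0 //.
  have /andP[_ /ltW h] := truncn_itv (ltW t0).
  apply: le_trans h _; rewrite natr1 ler_nat /i; lia.
have hj : n%:R * profile (t / theta / n%:R) <=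
    n%:R * profile ((maxn j 1)%:R / n%:R) + d%:R * d.+1%:R.
  have -> : n%:R * profile ((maxn j 1)%:R / n%:R) + d%:R * d.+1%:R
     = n%:R * (profile ((maxn j 1)%:R / n%:R) + d%:R * (d.+1%:R / n%:R)).
    by field; rewrite gt_eqF.
  rewrite ler_pM2l //; apply: profile_lip => //; first by rewrite divr_gt0.
  rewrite -mulrDl ler_pM2r ?invr_gt0 //.
  apply: (@le_trans _ _ (Num.truncn (t / theta) + d.+1)%:R).
    by rewrite ler_nat /j; lia.
  by rewrite natrD lerD2r truncn_le ltW.
have hs : n%:R * profile (t / n%:R) <=
    n%:R * profile (t / theta / n%:R) + (t / theta - t) * phi theta.
  have -> : n%:R * profile (t / theta / n%:R) + (t / theta - t) * phi theta =
    n%:R * (profile (t / n%:R / theta) + (t / n%:R / theta - t / n%:R) * phi theta).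
    rewrite mulrDr [t / n%:R / theta]mulrAC; congr (_ + _).
    by field; rewrite !gt_eqF.
  by rewrite ler_pM2l // profile_scale // divr_gt0.
have h1 := level_le i; have h2 := level_ge j.
rewrite -[(level n j).+1]addn1 natrD mulrDr mulr1 in h2.
have -> : d.+3%:R = d.+1%:R + 1 + 1 :> R by rewrite !natr1.
rewrite !mulrDr !mulr1; lra.
Qed.

Lemma level_lower (theta : R) (i a : nat) : 0 < theta < 1 ->
  i%:R <= theta * n%:R + a%:R ->
  n%:R * ((1 - theta) * phi theta) <= d%:R * (level n i).+1%:R + d%:R * (a.+1)%:R.
Proof.
move=> /andP[t0 t1] hi.
have -> : (1 - theta) * phi theta = profile theta by rewrite /profile t1.
apply: le_trans (_ : _ <= n%:R * (profile ((maxn i 1)%:R / n%:R) + d%:R * (a.+1%:R / n%:R))) _.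
  rewrite ler_pM2l //; apply: profile_lip => //.
  rewrite -{1}[theta](mulfK (lt0r_neq0 nR)) -mulrDl ler_pM2r ?invr_gt0 //.
  have : (maxn i 1)%:R <= i%:R + 1 :> R by rewrite natr1 ler_nat; lia.
  move/le_trans; apply; rewrite -natr1; lra.
rewrite mulrDr; apply: lerD; first exact: level_ge.
by rewrite mulrCA [n%:R * _]mulrC divfK // gt_eqF.
Qed.

End Profile.

(** * Covering numbers *)

Lemma divn_near (m z w : nat) : (0 < m)%N -> (z <= w + m)%N -> (w <= z + m)%N ->
  (z %/ m \in [:: (w %/ m).-1; w %/ m; (w %/ m).+1])%N.
Proof.
move=> m0 zw wz.
have h1 : (z %/ m <= (w %/ m).+1)%N.
  by have := leq_div2r m zw; rewrite divnDr ?dvdnn // divnn m0 addn1.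
have h2 : (w %/ m <= (z %/ m).+1)%N.
  by have := leq_div2r m wz; rewrite divnDr ?dvdnn // divnn m0 addn1.
move: (z %/ m)%N (w %/ m)%N h1 h2 => a b h1 h2; rewrite !inE.
by case: (ltngtP a b) => h; apply/or3P;
  [constructor 1|constructor 3|constructor 2]; apply/eqP; lia.
Qed.

(** The first [i] digits of a code near [w] form one of three neighbouring numbers, each extended to
    [j] digits in [2 ^ (g i - g j)] ways. Prefixes that do not occur, or occur twice when [q = 0],
    are kept so that the size is exact. *)
Lemma codes_cover (g : nat -> nat) (n i j w : nat) :
  (forall k, g k.+1 <= g k <= (g k.+1).+1)%N -> (i <= j <= n)%N ->
  exists2 s : seq nat, (size s * 2 ^ g j = 3 * 2 ^ g i)%N &
    forall z, z \in codes g 0 n 0 -> (z <= w + 2 ^ (n - i))%N ->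
      (w <= z + 2 ^ (n - i))%N -> (z %/ 2 ^ (n - j))%N \in s.
Proof.
move=> g_step /andP[ij jn].
set q := (w %/ 2 ^ (n - i))%N.
exists (flatten [seq codes g i (j - i) p | p <- [:: q.-1; q; q.+1]]).
  have sz p : (size (codes g i (j - i) p) * 2 ^ g j = 2 ^ g i)%N.
    by rewrite -{2}(subnKC ij) size_codes.
  by rewrite /= !size_cat addn0 !mulnDl !sz; lia.
move=> z hz zw wz; apply/flattenP.
exists (codes g i (j - i) (z %/ 2 ^ (n - i))).
  by apply: map_f; rewrite divn_near // expn_gt0.
have -> : (z %/ 2 ^ (n - i) = z %/ 2 ^ (n - j) %/ 2 ^ (j - i))%N.
  by rewrite -divnMA -expnD; congr (_ %/ 2 ^ _)%N; lia.
rewrite -{1}[i]add0n; apply: (@codes_suffix _ _ _ _ 0); rewrite subnKC //.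
by apply: codes_prefix; rewrite subnKC.
Qed.

Section Covering.
Variables (R : realType) (d : nat).

Lemma coord_le_enorm (x : 'rV[R]_d) k : `|x 0 k| <= enorm x.
Proof.
rewrite /enorm -sqrtr_sqr ler_sqrt; last by apply: sumr_ge0 => i _; exact: sqr_ge0.
by rewrite (bigD1 k) //= lerDl; apply: sumr_ge0 => i _; exact: sqr_ge0.
Qed.

(** The crude factor [2 ^ d] in place of the square root of [d] costs a whole number of binary
    digits. *)
Lemma enorm_lt (x : 'rV[R]_d) (r : R) : 0 < r ->
  (forall k, `|x 0 k| <= r / 2 ^+ d) -> enorm x < r.
Proof.
move=> r0 hx; rewrite /enorm -[ltRHS]ger0_norm ?(ltW r0) // -sqrtr_sqr.
rewrite ltr_sqrt; last by rewrite exprn_gt0.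
apply: (@le_lt_trans _ _ (\sum_(i < d) (r / 2 ^+ d) ^+ 2)).
  apply: ler_sum => i _; rewrite -real_normK ?num_real //.
  by rewrite lerXn2r ?nnegrE // ?(le_trans _ (hx i)).
rewrite sumr_const card_ord -[_ *+ d]mulr_natl expr_div_n mulrCA gtr_pMr ?exprn_gt0 //.
rewrite ltr_pdivrMr ?exprn_gt0 // mul1r -exprM mulnC exprM.
by rewrite -!natrX ltr_nat; exact: ltn_expl.
Qed.

(** The centres form a grid: one of [m] candidates is picked independently for each coordinate. *)
Lemma covering_number_le (m : nat) (c : 'I_d -> 'I_m -> R) (r : R)
    (E : set 'rV[R]_d) : 0 < r ->
  (forall y, E y -> forall k, exists i, `|y 0 k - c k i| <= r / 2 ^+ d) ->
  (covering_number r E <= (m ^ d)%:R%:E)%E.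
Proof.
move=> r0 hE; apply: ge_ereal_inf; eexists; last exact: lexx.
exists (m ^ d)%N => //=.
have cardE : #|{ffun 'I_d -> 'I_m}| = (m ^ d)%N by rewrite card_ffun !card_ord.
exists (fun i => \row_k c k (enum_val (cast_ord (esym cardE) i) k)).
move=> y /hE /choice[a ha].
exists (cast_ord cardE (enum_rank [ffun k => a k])) => //=.
apply: enorm_lt => // k; rewrite !mxE cast_ordK enum_rankK ffunE.
exact: ha.
Qed.

(** Packing bound: two points in one ball of radius [r] differ by less than [2 r] in every
    coordinate, so a ball holds at most one point of the grid. *)
Lemma covering_number_ge (T : eqType) (s : seq T) (f : T -> R) (r : R)
    (E : set 'rV[R]_d) : uniq s ->
  {in s &, forall u v, `|f u - f v| < 2 * r -> u = v} ->
  (forall z : 'I_d -> T, (forall k, z k \in s) -> E (\row_k f (z k))) ->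
  ((size s ^ d)%:R%:E <= covering_number r E)%E.
Proof.
move=> s_uniq f_sep hE; apply/ereal_infP => _ [n [c hc] <-].
rewrite lee_fin ler_nat.
have hb (z : {ffun 'I_d -> 'I_(size s)}) :
    exists i : 'I_n, eball (c i) r (\row_k f (tnth (in_tuple s) (z k))).
  have [|i _ hi] := hc (\row_k f (tnth (in_tuple s) (z k))); last by exists i.
  by apply: hE => k; exact: mem_tnth.
have [b hb'] := choice hb.
suff b_inj : injective b.
  by have := leq_card b b_inj; rewrite card_ffun !card_ord.
move=> z w bzw; apply/ffunP => k.
have /tuple_uniqP s_inj : uniq (in_tuple s) by [].
apply: s_inj; apply: f_sep; [exact: mem_tnth|exact: mem_tnth|].
have h1 := le_lt_trans (coord_le_enorm _ k) (hb' z).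
have := le_lt_trans (coord_le_enorm _ k) (hb' w).
rewrite -bzw !mxE in h1 *; move=> h2.
rewrite (_ : f _ - f _ = (f (tnth (in_tuple s) (z k)) - c (b z) 0 k)
  - (f (tnth (in_tuple s) (w k)) - c (b z) 0 k)); last by ring.
apply: le_lt_trans (ler_normB _ _) _; lra.
Qed.

End Covering.

(** * Realization of class A as Assouad spectra *)

Section Realization.
Variables (R : realType) (d : nat) (phi : R -> R).

(* The shifts by [3 * n] let a ball of radius at most [1] meet only one block. *)
Definition moran : set 'rV[R]_d :=
  [set y | exists (n : nat) (z : 'I_d -> nat),
    [/\ (0 < n)%N, forall k, z k \in codes (level d phi n) 0 n 0 &
        forall k, y 0 k = (z k)%:R / 2 ^+ n + (3 * n)%:R]].

Hypothesis phiA : class_A d phi.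
Hypothesis d_gt0 : (0 < d)%N.

Let p2 (x : R) : R := 2 `^ x.

Let p2_gt0 x : 0 < p2 x. Proof. exact: powR_gt0. Qed.

Let p2D x y : p2 (x + y) = p2 x * p2 y.
Proof. by rewrite /p2 powRD // pnatr_eq0 implybT. Qed.

Let p2N x : p2 (- x) = (p2 x)^-1. Proof. exact: powRN. Qed.

Let p2n n : p2 n%:R = 2 ^+ n. Proof. by rewrite /p2 powR_mulrn. Qed.

Let p2_le x y : x <= y -> p2 x <= p2 y.
Proof. by apply: ler_powR; rewrite ler1n. Qed.

Let p2X x n : p2 x ^+ n = p2 (n%:R * x).
Proof. by rewrite mulrC /p2 powRrM powR_mulrn // powR_ge0. Qed.

Let code_lt n z : z \in codes (level d phi n) 0 n 0 -> z%:R / 2 ^+ n < 1 :> R.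
Proof.
move=> /codes_div h; rewrite ltr_pdivrMr ?exprn_gt0 // mul1r -natrX ltr_nat.
by rewrite ltnNge -divn_gt0 ?expn_gt0 // h.
Qed.

Lemma same_block (x y : 'rV[R]_d) n m (z w : 'I_d -> nat) :
  (forall k, z k \in codes (level d phi n) 0 n 0) ->
  (forall k, x 0 k = (z k)%:R / 2 ^+ n + (3 * n)%:R) ->
  (forall k, w k \in codes (level d phi m) 0 m 0) ->
  (forall k, y 0 k = (w k)%:R / 2 ^+ m + (3 * m)%:R) ->
  enorm (y - x) < 1 -> m = n.
Proof.
move=> hz hx hw hy yx; pose k := Ordinal d_gt0.
have := le_lt_trans (coord_le_enorm _ k) yx.
have := code_lt (hz k); have := code_lt (hw k).
have : 0 <= (z k)%:R / 2 ^+ n :> R by rewrite divr_ge0.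
have : 0 <= (w k)%:R / 2 ^+ m :> R by rewrite divr_ge0.
rewrite !mxE hx hy !natrM.
move: (_ / 2 ^+ m) (_ / 2 ^+ n) => a b a0 b0 a1 b1.
rewrite ltr_norml => /andP[h1 h2].
case: (ltngtP m n) => // h; exfalso.
  have : m.+1%:R <= n%:R :> R by rewrite ler_nat.
  rewrite -natr1; lra.
have : n.+1%:R <= m%:R :> R by rewrite ler_nat.
rewrite -natr1; lra.
Qed.

Lemma moran_upper theta : 0 < theta < 1 -> exists2 C : R, 0 < C &
  forall (delta : R) (x : 'rV[R]_d), 0 < delta <= 1 -> moran x ->
    (covering_number (delta `^ theta^-1)%R (moran `&` eball x delta)
       <= (C * (delta / delta `^ theta^-1) `^ (phi theta))%R%:E)%E.
Proof.
move=> th; have /andP[th0 th1] := th.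
(* Three prefixes for each of the [d] coordinates, times the bounded error of [level_drop_upper]. *)
exists (3 ^+ d * p2 (d%:R * d.+3%:R)); first by rewrite mulr_gt0 ?exprn_gt0.
(* For [delta = 1] both radii are 1 and one ball suffices; [delta < 1] gives [t > 0] and confines
   the ball to one block. *)
move=> delta x /andP[delta0]; rewrite le_eqVlt => /predU1P[->|delta1] mx.
  rewrite powR1 divr1 powR1 mulr1; apply: ge_ereal_inf.
  exists 1%:E; last first.
    rewrite lee_fin -[leLHS]mulr1 ler_pM // ?exprn_ege1 ?ler1n //.
    by have := @p2_le 0 (d%:R * d.+3%:R); rewrite {1}/p2 powRr0; apply.
  by exists 1%N => //=; exists (fun=> x) => y [_ hy]; exists ord0.
set t := - (ln delta / ln 2).
have ln2 : 0 < ln 2 :> R by rewrite ln_gt0 // ltr1n.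
have t0 : 0 < t by rewrite /t -mulNr divr_gt0 // oppr_gt0 ln_lt0 // delta0.
have deltaE : delta = p2 (- t).
  apply: (@ln_inj R); rewrite ?posrE ?p2_gt0 //.
  by rewrite /p2 ln_powR opprK divfK // gt_eqF.
have rE : delta `^ theta^-1 = p2 (- (t / theta)).
  by rewrite deltaE /p2 -powRrM mulNr.
have t_le : t <= t / theta by rewrite ler_pdivlMr // ger_pMr // ltW.
have tth0 : 0 <= t / theta by lra.
case: mx => n [z [n0 hz hx]].
set g := level d phi n.
set i := minn (Num.truncn t) n.
(* Of the [d + 1] extra digits, [d] pay for the factor in [enorm_lt] and one for rounding
   [t / theta] down. *)
set j := minn (Num.truncn (t / theta) + d.+1) n.
have ijn : (i <= j <= n)%N by rewrite /i /j; have := le_truncn t_le; lia.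
have /andP[ij jn] := ijn; have i_n := leq_trans ij jn.
have it : i%:R <= t.
  by apply: le_trans (_ : (Num.truncn t)%:R <= _); rewrite ?ler_nat ?geq_minl // truncn_le ltW.
have g_step := level_step phiA d_gt0 n0.
pose m := (3 * 2 ^ g i %/ 2 ^ g j)%N.
have sizeE (s : seq nat) : (size s * 2 ^ g j = 3 * 2 ^ g i)%N -> size s = m.
  by rewrite /m => <-; rewrite mulnK // expn_gt0.
have cover k : exists s : seq nat, size s = m /\
    forall w, w \in codes g 0 n 0 -> (w <= z k + 2 ^ (n - i))%N ->
      (z k <= w + 2 ^ (n - i))%N -> (w %/ 2 ^ (n - j))%N \in s.
  have [s hs hs'] := codes_cover (z k) g_step ijn.
  by exists s; split=> //; exact: sizeE.
have m_eq : (m * 2 ^ g j = 3 * 2 ^ g i)%N.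
  by have [s hs _] := codes_cover 0 g_step ijn; rewrite -(sizeE s hs).
have [s s_cover] := choice cover.
pose c (k : 'I_d) (a : 'I_m) : R :=
  (nth 0%N (s k) a * 2 ^ (n - j))%:R / 2 ^+ n + (3 * n)%:R.
have n2 : 0 < 2 ^+ n :> R by rewrite exprn_gt0.
apply: (@le_trans _ _ (m ^ d)%:R%:E).
  apply: (covering_number_le (c := c)); first by rewrite rE.
  move=> y [[n' [w [n0' hw hy]]] yx] k.
  have nn' : n' = n by apply: same_block hz hx hw hy _; exact: lt_trans yx delta1.
  subst n'.
  have := le_lt_trans (coord_le_enorm _ k) yx; rewrite !mxE hx hy.
  rewrite opprD addrACA subrr addr0 -mulrBl normrM normfV.
  rewrite (gtr0_norm n2) ltr_pdivrMr // => dist.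
  have dist' : `|(w k)%:R - (z k)%:R| <= (2 ^ (n - i))%:R :> R.
    apply: le_trans (ltW dist) _; rewrite natrX -!p2n deltaE -p2D; apply: p2_le.
    rewrite natrB //; lra.
  have [w1 w2] : (w k <= z k + 2 ^ (n - i))%N /\ (z k <= w k + 2 ^ (n - i))%N.
    move: dist'; rewrite ler_norml => /andP[h1 h2].
    split; rewrite -(ler_nat R) [X in _ <= X]natrD -lerBlDl //.
    by rewrite -lerN2 opprB.
  clear dist'; have [size_s hs] := s_cover k; have ws := hs _ (hw k) w1 w2.
  have wlt : (index (w k %/ 2 ^ (n - j)) (s k) < m)%N by rewrite -size_s index_mem.
  exists (Ordinal wlt); rewrite /c /= nth_index // opprD addrACA subrr addr0.
  rewrite -mulrBl -natrB ?leq_divM // normrM normfV (gtr0_norm n2) ger0_norm //.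
  have -> : (w k - w k %/ 2 ^ (n - j) * 2 ^ (n - j) = w k %% 2 ^ (n - j))%N.
    by rewrite {1}(divn_eq (w k) (2 ^ (n - j))) addnC addnK.
  rewrite ler_pdivrMr //.
  (* If [j] is capped at [n], the prefix is the whole code and the centre is exact. *)
  have [jn'|jn'] := leqP n (Num.truncn (t / theta) + d.+1).
    rewrite (_ : j = n); last exact/minn_idPr.
    by rewrite subnn modn1 mulr_ge0 // divr_ge0 // ?rE ltW.
  apply: (@le_trans _ _ (2 ^ (n - j))%:R).
    by rewrite ler_nat ltnW // ltn_mod expn_gt0.
  rewrite natrX rE -!p2n -p2N -!p2D; apply: p2_le; rewrite natrB //.
  have -> : j = (Num.truncn (t / theta) + d.+1)%N by exact/minn_idPl/ltnW.
  have /andP[_ /ltW] := truncn_itv tth0.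
  rewrite natrD -[d.+1%:R]natr1 -[_.+1%:R]natr1; lra.
rewrite lee_fin natrX.
have -> : m%:R = 3 * p2 ((g i)%:R - (g j)%:R) :> R.
  apply: (mulIf (lt0r_neq0 (p2_gt0 (g j)%:R))); rewrite -mulrA -p2D subrK.
  by rewrite !p2n -!natrX -!natrM m_eq.
rewrite exprMn -mulrA ler_pM2l ?exprn_gt0 // p2X rE deltaE -p2N -p2D -powRrM.
rewrite -p2D; apply: p2_le.
have := level_drop_upper phiA d_gt0 n0 t0 th; rewrite /= -/g -/i -/j; lra.
Qed.

(* For [delta = 2 ^ -(theta (n + 1))] a covering ball has radius [2 ^ -(n + 1)],
   hence contains at most one point of the [n]-th block. *)
Lemma moran_lower theta alpha C : 0 < theta < 1 -> 0 < C ->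
  (forall (delta : R) (x : 'rV[R]_d), 0 < delta <= 1 -> moran x ->
    (covering_number (delta `^ theta^-1)%R (moran `&` eball x delta)
       <= (C * (delta / delta `^ theta^-1) `^ alpha)%R%:E)%E) ->
  phi theta <= alpha.
Proof.
move=> th C0 hC; have /andP[th0 th1] := th.
have ln2 : 0 < ln 2 :> R by rewrite ln_gt0 // ltr1n.
(* Errors independent of [n]: rounding in [level_lower] with [a = d + 2], the constant [C], and the
   passage from [n + 1] to [n] in the exponent. *)
set K := d%:R * d.+4%:R + `|ln C| / ln 2 + `|alpha|.
have bound (n : nat) : (0 < n)%N -> theta * n%:R + d.+2%:R <= n%:R ->
    n%:R * ((1 - theta) * phi theta) <= n%:R * (1 - theta) * alpha + K.
  move=> n0 n_large; set g := level d phi n.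
  have g_step : forall j, (g j.+1 <= g j <= (g j.+1).+1)%N.
    exact: level_step phiA d_gt0 _ n0.
  set t := theta * n.+1%:R; have t0 : 0 <= t by rewrite mulr_ge0 // ltW.
  (* Since [t + d <= i], changing only digits after position [i] moves a coordinate by at most
     [2 ^ -t / 2 ^ d], as [enorm_lt] requires. *)
  set i := (Num.truncn t + d.+1)%N.
  have it : t + d%:R <= i%:R.
    have /andP[_ /ltW] := truncn_itv t0.
    by rewrite /i natrD -[d.+1%:R]natr1 -natr1; lra.
  have ti : i%:R <= theta * n%:R + d.+2%:R.
    have := truncn_le t; rewrite t0 /i /t natrD -[n.+1%:R]natr1 -[d.+2%:R]natr1; lra.
  have i_n : (i <= n)%N by rewrite -(ler_nat R) (le_trans ti).
  have gn : g n = 0%N by rewrite /g level_last.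
  (* Codes whose first [i] digits vanish; as [g n = 0] there are exactly [2 ^ g i] of them. *)
  pose s := codes g i (n - i) 0.
  have size_s : size s = (2 ^ g i)%N.
    by have := size_codes g_step i (n - i) 0; rewrite subnKC // gn muln1.
  have n2 : 0 < 2 ^+ n :> R by rewrite exprn_gt0.
  pose f (w : nat) : R := w%:R / 2 ^+ n + (3 * n)%:R.
  pose x0 : 'rV[R]_d := \row_k f 0%N.
  have mx0 : moran x0.
    exists n, (fun=> 0%N); split => // k; first exact: codes0.
    by rewrite mxE.
  have s_code w : w \in s -> w \in codes g 0 n 0.
    move=> ws; rewrite -(subnKC i_n).
    exact: (@codes_cat g 0 i (n - i) 0 0) (codes0 _ _ _) _.
  have := hC (p2 (- t)) x0 _ mx0.
  have -> : p2 (- t) `^ theta^-1 = p2 (- n.+1%:R).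
    by rewrite -powRrM /t mulNr mulrC mulKf // gt_eqF.
  have -> : 0 < p2 (- t) <= 1.
    rewrite p2_gt0 /=; have := @p2_le (- t) 0; rewrite {2}/p2 powRr0; apply.
    by rewrite oppr_le0.
  move=> /(_ isT); set E := moran `&` _ => hE.
  have packing : ((size s ^ d)%:R%:E <= covering_number (p2 (- n.+1%:R)) E)%E.
    apply: (covering_number_ge (f := f)); first exact: codes_uniq.
      move=> u v _ _; rewrite /f opprD addrACA subrr addr0 -mulrBl normrM normfV.
      rewrite (gtr0_norm n2) p2N p2n exprS invfM mulVKf // ltr_pdivrMr //.
      rewrite mulVf ?gt_eqF // ltr_norml => /andP[h1 h2].
      apply/eqP; rewrite eqn_leq; apply/andP.
      by split; rewrite -ltnS -(ltr_nat R) -[_.+1%:R]natr1; lra.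
    move=> z hz; split.
      by exists n, z; split=> // k; [exact: s_code|rewrite mxE].
    apply: enorm_lt => // k; rewrite !mxE /f opprD addrACA subrr addr0 mul0r subr0.
    rewrite ger0_norm ?divr_ge0 //.
    apply: (@le_trans _ _ (2 ^+ (n - i) / 2 ^+ n)).
      rewrite ler_pM2r ?invr_gt0 // -natrX ler_nat ltnW //.
      by rewrite ltnNge -divn_gt0 ?expn_gt0 // (codes_div (hz k)).
    rewrite -!p2n -!p2N -!p2D; apply: p2_le; rewrite natrB //; lra.
  have := le_trans packing hE; rewrite lee_fin size_s !natrX -p2n p2X.
  rewrite -p2N opprK -p2D -powRrM -/(p2 _) => h.
  have : ln (p2 (d%:R * (g i)%:R)) <= ln (C * p2 ((- t + n.+1%:R) * alpha)).
    by rewrite ler_ln // posrE ?mulr_gt0.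
  rewrite lnM ?posrE // !ln_powR -ler_pdivlMr // mulrDl mulfK ?gt_eqF // => h1.
  have := level_lower phiA d_gt0 n0 th ti; rewrite -/g => h2.
  have h3 : ln C / ln 2 <= `|ln C| / ln 2 by rewrite ler_pM2r ?invr_gt0 // ler_norm.
  have h4 : (1 - theta) * alpha <= `|alpha|.
    apply: le_trans (ler_norm _) _; rewrite normrM ler_piMl //.
    by rewrite ger0_norm; lra.
  move: h1 h2 h3 h4; rewrite /K /t -[n.+1]addn1 -[d.+4]addn4 -[d.+3]addn3.
  rewrite -[(g i).+1]addn1 !natrD.
  move: (ln C / _) (`|ln C| / _) `|alpha| => u v w. lra.
rewrite leNgt; apply/negP => alpha_lt.
have gap : 0 < (1 - theta) * (phi theta - alpha) by rewrite mulr_gt0 // subr_gt0.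
have K0 : 0 <= K by rewrite /K !addr_ge0 // ?mulr_ge0 // invr_ge0 ltW.
have th1' : 0 < 1 - theta by rewrite subr_gt0.
(* [n] exceeds both quotients: the first makes [bound] applicable, the second contradicts it. *)
pose n := (Num.truncn (d.+2%:R / (1 - theta) + K / ((1 - theta) * (phi theta - alpha)))).+1.
have a0 : 0 <= d.+2%:R / (1 - theta) by rewrite divr_ge0 // ltW.
have b0 : 0 <= K / ((1 - theta) * (phi theta - alpha)) by rewrite divr_ge0 // ltW.
have /andP[_ hn] := truncn_itv (addr_ge0 a0 b0).
have n1 : d.+2%:R < n%:R * (1 - theta).
  by rewrite -ltr_pdivrMr //; apply: le_lt_trans hn; rewrite lerDl.
have n2 : K < n%:R * ((1 - theta) * (phi theta - alpha)).
  by rewrite -ltr_pdivrMr //; apply: le_lt_trans hn; rewrite lerDr.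
have := bound n isT; have -> : theta * n%:R + d.+2%:R <= n%:R by lra.
move=> /(_ isT); lra.
Qed.

Lemma moran_spectrum theta : 0 < theta < 1 ->
  assouad_spectrum moran theta = (phi theta)%:E.
Proof.
move=> th; apply/eqP; rewrite eq_le; apply/andP; split.
  by apply: ge_ereal_inf; exists (phi theta)%:E => //; exists (phi theta) => //;
    exact: moran_upper.
apply/ereal_infP => _ [alpha [C C0 hC] <-].
by rewrite lee_fin; exact: moran_lower C0 hC.
Qed.

End Realization.

(** * Lebesgue measure on intervals *)

(** Adjoining the points [1 / (n + 2)] makes the set infinite, so an injective enumeration exists
    even for finite [L]. Injectivity will keep the radii positive. *)
Lemma countable_sequence (R : realType) (L : set R) :
  countable L -> L `<=` `]0, 1[%classic ->
  exists lam : nat -> R, [/\ injective lam, forall n, 0 < lam n < 1 &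
    forall x, L x -> exists n, lam n = x].
Proof.
move=> L_count L01.
pose q (n : nat) : R := n.+2%:R^-1.
have q_inj : injective q by move=> m n /invr_inj /eqP; rewrite eqr_nat => /eqP[].
pose A := L `|` range q.
have A_count : countable A.
  by rewrite /A -bigcup2E; apply: bigcup_countable => // -[|[|k]] _ //=;
    exact: sub_countable (card_image_le _ _) _.
have A_inf : infinite_set A.
  apply: (@sub_infinite_set _ (range q)); first exact: subsetUr.
  rewrite (eq_finite_set (inj_card_eq _)); first exact: infinite_nat.
  by move=> m n _ _; exact: q_inj.
have := eq_card_nat A_count A_inf; rewrite card_eq_sym.
move=> /card_set_bijP[lam [lam_fun lam_inj lam_surj]].
exists lam; split.
- by move=> m n; apply: lam_inj; rewrite in_setE.
- move=> n; have [/L01|[m _ <-]] := lam_fun n I; first by rewrite /= in_itv.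
  by rewrite invr_gt0 ltr0n /= invf_lt1 ?ltr0n // ltr1n.
- by move=> x Lx; have [|n _ <-] := lam_surj x; [left|exists n].
Qed.

Section Length.
Variable R : realType.
Implicit Types (S T : set R) (x y z : R).

(** Half-open intervals make [len_cat] a disjoint union. *)
Definition len S x y : R := fine (lebesgue_measure (S `&` `]x, y])).

Let mI S x y : measurable S -> measurable (S `&` `]x, y]).
Proof. by move=> mS; exact: measurableI. Qed.

Let itv_measure x y : x <= y -> lebesgue_measure (`]x, y] : set R) = (y - x)%:E.
Proof.
move=> xy; rewrite lebesgue_measure_itv /= lte_fin; case: ltP => // yx.
by rewrite (_ : y = x) ?subrr //; apply/eqP; rewrite eq_le yx.
Qed.

Let len_lty S x y : measurable S ->
  (lebesgue_measure (S `&` `]x, y]) < +oo)%E.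
Proof.
move=> mS; apply: le_lt_trans (_ : lebesgue_measure (`]x, y] : set R) < +oo)%E.
  by apply: le_measure; rewrite ?inE //; do ?[exact: mI|exact: subIsetr].
by rewrite lebesgue_measure_itv /=; case: ifP => // _; rewrite -EFinB ltry.
Qed.

Lemma lenE S x y : measurable S ->
  (len S x y)%:E = lebesgue_measure (S `&` `]x, y]).
Proof.
by move=> mS; rewrite /len fineK // ge0_fin_numE // len_lty.
Qed.

Lemma len_ge0 S x y : 0 <= len S x y.
Proof. exact: fine_ge0. Qed.

Lemma len_le S x y : measurable S -> x <= y -> len S x y <= y - x.
Proof.
move=> mS xy; rewrite -lee_fin lenE // -itv_measure //.
by apply: le_measure; rewrite ?inE //; do ?[exact: mI|exact: subIsetr].
Qed.

Lemma len_xx S x : len S x x = 0.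
Proof. by rewrite /len set_itvoc0 // setI0 measure0. Qed.

Lemma len_cat S x y z : measurable S -> x <= y -> y <= z ->
  len S x z = len S x y + len S y z.
Proof.
move=> mS xy yz; apply: EFin_inj; rewrite EFinD !lenE //.
rewrite -measureU; [|exact: mI|exact: mI|].
  rewrite -setIUr; congr (lebesgue_measure (_ `&` _)).
  apply/seteqP; split => u /=; rewrite !in_itv /=.
    by move=> /andP[xu uz]; case: (leP u y) => uy; [left|right]; apply/andP.
  by case=> /andP[h1 h2]; apply/andP; split; lra.
rewrite setIACA setIid; apply/seteqP; split => u //= [_ []].
by rewrite !in_itv /= => /andP[_ h1] /andP[h2 _]; lra.
Qed.

Lemma len_subset S T x y : measurable S -> measurable T ->
  S `&` `]x, y] `<=` T -> len S x y <= len T x y.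
Proof.
move=> mS mT ST; rewrite -lee_fin !lenE //; apply: le_measure; rewrite ?inE //;
  [exact: mI|exact: mI|].
by move=> u [Su xy]; split=> //; apply: ST.
Qed.

Lemma len_full S x y : measurable S -> x <= y -> `]x, y] `<=` S ->
  len S x y = y - x.
Proof.
move=> mS xy xyS; apply: EFin_inj; rewrite lenE // -itv_measure //.
by congr (lebesgue_measure _); exact: setIidr.
Qed.

Lemma len_coverU S T x y : measurable S -> measurable T -> x <= y ->
  `]x, y] `<=` S `|` T -> y - x <= len S x y + len T x y.
Proof.
move=> mS mT xy ST; rewrite -lee_fin [leRHS]EFinD !lenE // -itv_measure //.
have := @measureU2 _ _ _ (@lebesgue_measure R) _ _ (mI x y mS) (mI x y mT).
apply: le_trans; apply: le_measure; rewrite ?inE //.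
  by apply: measurableU; exact: mI.
by move=> u xyu; have [Su|Tu] := ST u xyu; [left|right].
Qed.

(** Countable subadditivity; the bounds [K / 2 ^ (n + 1)] sum to [K]. *)
Lemma len_bigcup (F : nat -> set R) x y K : 0 <= K ->
  (forall n, measurable (F n)) ->
  (forall n, (lebesgue_measure (F n `&` `]x, y]) <= (K / (2 ^ n.+1)%:R)%:E)%E) ->
  len (\bigcup_n F n) x y <= K.
Proof.
move=> K0 mF hF; have mU : measurable (\bigcup_n F n) by exact: bigcupT_measurable.
rewrite -lee_fin lenE //.
apply: le_trans (epsilon_trick0 xpredT K0).
have := @measure_sigma_subadditive _ _ _ (@lebesgue_measure R) _ _
  (fun n => mI x y (mF n)) (mI x y mU).
rewrite setI_bigcupl => /(_ (@subset_refl _ _)) /le_trans; apply.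
by apply: lee_nneseries => // n _; exact: hF.
Qed.

End Length.

(** * A small Lipschitz function with a spike at each point of a sequence *)

Section Spikes.
Variables (R : realType) (lam : nat -> R) (eta : R).
Hypothesis lam_inj : injective lam.
Hypothesis lam01 : forall n, 0 < lam n < 1.
Hypothesis eta01 : 0 < eta <= 1.

(* The product bounds [radius m] by a small multiple of each distance
   [`|lam m - lam n|] with [n < m]. *)
Definition radius (m : nat) : R :=
  eta / (2 ^ m.+4)%:R * (lam m * (1 - lam m)) * \prod_(n < m) `|lam m - lam n|.

Let weight m : R := eta / (2 ^ m.+4)%:R.

Let weight_gt0 m : 0 < weight m.
Proof. by case/andP: eta01 => e0 _; rewrite divr_gt0 // ltr0n expn_gt0. Qed.

Let weight_le m : weight m <= 1 / 2.
Proof.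
case/andP: eta01 => e0 e1; rewrite /weight ler_pdivrMr ?ltr0n ?expn_gt0 //.
apply: le_trans e1 _; rewrite expnS natrM mulrA mul1r mulVf ?pnatr_eq0 // mul1r.
by rewrite ler1n expn_gt0.
Qed.


(** The exponent [m + 4] leaves a factor 8 to spend in [len_all] and [len_tail] while the sum stays
    below [eta]. *)
Let weightE m : 8 * weight m = eta / (2 ^ m.+1)%:R.
Proof.
rewrite /weight !(expnS _ m.+3) !(expnS _ m.+2) !(expnS _ m.+1) !natrM.
by field; rewrite pnatr_eq0 -lt0n expn_gt0.
Qed.

Let factor_le1 m n : `|lam m - lam n| <= 1.
Proof. by move: (lam01 m) (lam01 n); rewrite ler_norml; lra. Qed.

Lemma radius_gt0 m : 0 < radius m.
Proof.
have /andP[l0 l1] := lam01 m.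
rewrite /radius -/(weight m) mulr_gt0 //; first by rewrite (mulr_gt0 (weight_gt0 m)) // mulr_gt0 // subr_gt0.
apply: prodr_gt0 => n _.
rewrite normr_gt0 subr_eq0; apply/eqP => /lam_inj mn.
by have := ltn_ord n; rewrite -mn ltnn.
Qed.

Lemma radius_le_margin m : radius m <= weight m * (lam m * (1 - lam m)).
Proof.
have /andP[l0 l1] := lam01 m.
rewrite /radius -/(weight m) ler_piMr //.
  by apply: ltW; rewrite (mulr_gt0 (weight_gt0 m)) // mulr_gt0 // subr_gt0.
by apply: prodr_ile1 => n _; rewrite normr_ge0 factor_le1.
Qed.

Lemma radius_le_dist m n : (n < m)%N -> radius m <= weight m * `|lam m - lam n|.
Proof.
move=> nm; have /andP[l0 l1] := lam01 m.
rewrite /radius -/(weight m) -mulrA ler_pM2l //.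
rewrite (bigD1 (Ordinal nm)) //= mulrCA ler_piMr //.
apply: mulr_ile1; rewrite ?prodr_ge0 //; [nra|nra|].
by apply: prodr_ile1 => i _; rewrite normr_ge0 factor_le1.
Qed.

Let ival m : set R := `[lam m - radius m, lam m + radius m]%classic.
Let tail m : set R := \bigcup_k (if (m < k)%N then ival k else set0).
Let all_ivals : set R := \bigcup_k ival k.
(** Removing [tail m] attributes a point to the last interval containing it; points of infinitely
    many intervals are in neither [rising] nor [falling]. *)
Let rising : set R :=
  \bigcup_m (`[lam m - radius m, lam m]%classic `\` tail m).
Let falling : set R :=
  \bigcup_m (`]lam m, lam m + radius m]%classic `\` tail m).

Let m_ival m : measurable (ival m). Proof. exact: measurable_itv. Qed.

Let m_tail m : measurable (tail m).
Proof. by apply: bigcupT_measurable => k; case: ifP. Qed.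

Let m_all : measurable all_ivals.
Proof. exact: bigcupT_measurable. Qed.

Let m_rising : measurable rising.
Proof. by apply: bigcupT_measurable => k; exact: measurableD. Qed.

Let m_falling : measurable falling.
Proof. by apply: bigcupT_measurable => k; exact: measurableD. Qed.

Let mu_ival m x y :
  (lebesgue_measure (ival m `&` `]x, y]) <= (2 * radius m)%:E)%E.
Proof.
have r0 := radius_gt0 m.
apply: (@le_trans _ _ (lebesgue_measure (ival m))).
  by apply: le_measure; rewrite ?inE;
    [apply: measurableI; [exact: m_ival|]|exact: m_ival|exact: subIsetl].
rewrite lebesgue_measure_itv /= lte_fin; case: ifP => _.
  by rewrite -EFinB lee_fin; lra.
by rewrite lee_fin mulr_ge0 // ltW.
Qed.

Let mu_ival_le m x y K : 0 <= K ->
  (forall u, ival m u -> x < u <= y -> 2 * radius m <= K) ->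
  (lebesgue_measure (ival m `&` `]x, y]) <= K%:E)%E.
Proof.
move=> K0 hK; have [->|/set0P[u [mu xy]]] := eqVneq (ival m `&` `]x, y]) set0.
  by rewrite measure0 lee_fin.
apply: le_trans (mu_ival m x y) _; rewrite lee_fin; apply: hK mu _.
by move: xy; rewrite /= in_itv.
Qed.

(** An interval meeting []x, y]] has radius at most half of [lam m] and of [1 - lam m], hence
    [lam m <= 2 y] and [1 - lam m <= 2 (1 - x)]. *)
Let len_all x y : 0 <= x -> x <= y -> y <= 1 ->
  len all_ivals x y <= eta * (y * (1 - x)).
Proof.
move=> x0 xy y1; have /andP[e0 e1] := eta01.
have K0 : 0 <= y * (1 - x) by apply: mulr_ge0; lra.
apply: len_bigcup => //; first by rewrite mulr_ge0 // ltW.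
move=> m; rewrite mulrAC -weightE; apply: mu_ival_le.
  by rewrite mulr_ge0 // mulr_ge0 // ltW.
move=> u; rewrite /ival /= in_itv /= => /andP[u1 u2] /andP[u3 u4].
have /andP[l0 l1] := lam01 m; have r_le := radius_le_margin m.
have w0 := weight_gt0 m; have w1 := weight_le m.
have small : radius m <= lam m / 2 /\ radius m <= (1 - lam m) / 2.
  have h : lam m * (1 - lam m) <= lam m /\ lam m * (1 - lam m) <= 1 - lam m.
    by split; nra.
  by split; nra.
have l2y : lam m <= 2 * y by lra.
have l2x : 1 - lam m <= 2 * (1 - x) by lra.
have prod_le : lam m * (1 - lam m) <= (2 * y) * (2 * (1 - x)).
  by apply: ler_pM => //; lra.
have : weight m * (lam m * (1 - lam m)) <= weight m * ((2 * y) * (2 * (1 - x))).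
  by rewrite ler_pM2l.
lra.
Qed.

(** A later interval that comes within [e] of [lam n] has radius at most half the distance of the
    centres, so this distance is at most [2 e]. The later intervals thus have density at most [eta]
    around [lam n] at every scale. *)
Let len_tail n x y e : 0 < e -> x <= y ->
  lam n - e <= x -> y <= lam n + e -> len (tail n) x y <= eta * e.
Proof.
move=> e0 xy xe ye; have /andP[et0 et1] := eta01.
apply: len_bigcup; [by rewrite mulr_ge0 // ltW|by move=> k; case: ifP|].
move=> m; rewrite mulrAC -weightE; have w0 := weight_gt0 m; have w1 := weight_le m.
have K0 : 0 <= 8 * weight m * e by rewrite !mulr_ge0 // ltW.
case: ifP => nm; last by rewrite set0I measure0 lee_fin.
apply: mu_ival_le => // u; rewrite /ival /= in_itv /= => /andP[u1 u2] /andP[u3 u4].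
have := radius_le_dist nm; set D := `|_| => r_le.
have D0 : 0 <= D by exact: normr_ge0.
have DD : D <= e + radius m by rewrite /D ler_norml; lra.
have r_half : radius m <= D / 2 by nra.
have : D <= 2 * e by lra.
move=> D2; have : weight m * D <= weight m * (2 * e) by rewrite ler_pM2l.
lra.
Qed.

Lemma spike_pair : exists v h : R -> R,
  [/\ v 0 = 0, h 0 = 0,
    forall x y, 0 <= x -> x <= y -> y <= 1 ->
      [/\ 0 <= v y - v x, v y - v x <= y - x, v y - v x <= eta * (y * (1 - x)) &
        `|h y - h x| <= v y - v x] &
    forall n, exists2 rho, 0 < rho & forall e, 0 < e -> e <= rho ->
      [/\ v (lam n + e) - v (lam n) = e,
          h (lam n + e) - h (lam n) <= - ((1 - 2 * eta) * e) &
          (1 - 2 * eta) * e <= h (lam n) - h (lam n - e)]].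
Proof.
pose v x := len all_ivals 0 x.
pose h x := len rising 0 x - len falling 0 x.
have vE x y : 0 <= x -> x <= y -> v y - v x = len all_ivals x y.
  by move=> x0 xy; rewrite /v (len_cat m_all x0 xy) addrC addKr.
have hE x y : 0 <= x -> x <= y -> h y - h x = len rising x y - len falling x y.
  move=> x0 xy; rewrite /h (len_cat m_rising x0 xy) (len_cat m_falling x0 xy).
  by ring.
have rising_sub : rising `<=` all_ivals.
  move=> u [m _ [hu _]]; exists m => //; move: hu; rewrite /ival /= !in_itv /=.
  by have := radius_gt0 m; lra.
have falling_sub : falling `<=` all_ivals.
  move=> u [m _ [hu _]]; exists m => //; move: hu; rewrite /ival /= !in_itv /=.
  by have := radius_gt0 m; lra.
have in_tail m n u : (n < m)%N -> ival m u -> tail n u.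
  by move=> nm hu; exists m => //; rewrite nm.
exists v, h; split.
- exact: len_xx.
- by rewrite /h !len_xx subrr.
- move=> x y x0 xy y1; rewrite vE // hE //; split.
  + exact: len_ge0.
  + exact: len_le.
  + exact: len_all.
  + have h1 : len rising x y <= len all_ivals x y.
      by apply: len_subset => // u [hu _]; exact: rising_sub.
    have h2 : len falling x y <= len all_ivals x y.
      by apply: len_subset => // u [hu _]; exact: falling_sub.
    have := len_ge0 rising x y; have := len_ge0 falling x y.
    by rewrite ler_norml; lra.
move=> n; exists (radius n); first exact: radius_gt0.
have /andP[l0 l1] := lam01 n.
have w0 := weight_gt0 n; have w1 := weight_le n; have r_le := radius_le_margin n.
have r_small : radius n <= lam n by nra.
move=> e e0 er.
have l_e : lam n <= lam n + e by lra.
have l_e' : lam n - e <= lam n by lra.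
have l_e0 : 0 <= lam n - e by lra.
rewrite vE ?hE //; last lra; last lra.
have near_n u : lam n - e < u <= lam n + e -> ival n u.
  by rewrite /ival /= in_itv /=; lra.
have tail_r := @len_tail n (lam n) (lam n + e) e e0 l_e.
have {}tail_r : len (tail n) (lam n) (lam n + e) <= eta * e by apply: tail_r; lra.
have tail_l := @len_tail n (lam n - e) (lam n) e e0 l_e'.
have {}tail_l : len (tail n) (lam n - e) (lam n) <= eta * e by apply: tail_l; lra.
split.
- rewrite len_full //; first lra.
  by move=> u; rewrite /= in_itv /= => hu; exists n => //; apply: near_n; lra.
- have cov : lam n + e - lam n <= len falling (lam n) (lam n + e)
      + len (tail n) (lam n) (lam n + e).
    apply: len_coverU => // u; rewrite /= in_itv /= => hu.
    have [hn|hn] := pselect (tail n u); [by right|left].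
    by exists n => //; split => //; rewrite /= in_itv /=; lra.
  have sub : len rising (lam n) (lam n + e) <= len (tail n) (lam n) (lam n + e).
    apply: len_subset => // u [[m _ [um mt]]]; rewrite /= in_itv /= => hu.
    move: um; rewrite /= in_itv /= => um.
    (* If [m < n], the point is in the later [ival n], so not attributed to [m]; if [n < m], it is
       in [tail n]; if [m = n], it is on the wrong side of [lam n]. *)
    have [mn|nm|mn] := ltngtP m n.
    + by case: mt; apply: in_tail mn _; apply: near_n; lra.
    + by apply: in_tail nm _; rewrite /ival /= in_itv /=; have := radius_gt0 m; lra.
    + by move: um hu; rewrite mn; lra.
  lra.
- have cov : lam n - (lam n - e) <= len rising (lam n - e) (lam n)
      + len (tail n) (lam n - e) (lam n).
    apply: len_coverU => // u; rewrite /= in_itv /= => hu.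
    have [hn|hn] := pselect (tail n u); [by right|left].
    by exists n => //; split => //; rewrite /= in_itv /=; lra.
  have sub : len falling (lam n - e) (lam n) <= len (tail n) (lam n - e) (lam n).
    apply: len_subset => // u [[m _ [um mt]]]; rewrite /= in_itv /= => hu.
    move: um; rewrite /= in_itv /= => um.
    have [mn|nm|mn] := ltngtP m n.
    + by case: mt; apply: in_tail mn _; apply: near_n; lra.
    + by apply: in_tail nm _; rewrite /ival /= in_itv /=; have := radius_gt0 m; lra.
    + by move: um hu; rewrite mn; lra.
  lra.
Qed.

End Spikes.

(** * Perturbation of an increasing function of class A *)

(** The slope bounds alone give the inequality without the factor 5/4. The bounds in [eta] make one
    term on the left almost negligible: that of [u] if [a <= 3 b], that of [w] otherwise. *)
Lemma spike_slack (R : realFieldType) (a b u w eta : R) :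
  0 < a -> a < 1 -> 0 < b -> b < 1 -> 0 < eta <= 1 / 100 ->
  u <= (1 - a) * b -> u <= eta * ((1 - a) * (a + b)) ->
  w <= (1 - b) * a -> w <= eta * ((1 - b) * (a + b)) ->
  5 / 4 * (a * u + (1 - a) * b * w)
    <= a * ((1 - a) * b) + (1 - a) * b * ((1 - b) * a).
Proof.
move=> a0 a1 b0 b1 /andP[eta0 eta1] u1 u2 w1 w2.
have a1' : 0 < 1 - a by lra.
have b1' : 0 < 1 - b by lra.
have T0 : 0 < a * (1 - a) * b by rewrite !mulr_gt0.
have Tb0 : 0 < a * (1 - a) * b * b by rewrite mulr_gt0.
have ab0 : 0 <= (1 - a) * b by rewrite ltW // mulr_gt0.
have [ab|ba] := leP a (3 * b).
- have h1 : u <= 1 / 100 * ((1 - a) * (4 * b)).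
    apply: le_trans u2 _; apply: ler_pM; rewrite ?(ltW eta0) //.
      by rewrite mulr_ge0 //; lra.
    by rewrite ler_pM2l //; lra.
  have h2 := ler_wpM2l (ltW a0) h1; have h3 := ler_wpM2l ab0 w1.
  lra.
- have h1 : w <= 1 / 100 * ((1 - b) * (2 * a)).
    apply: le_trans w2 _; apply: ler_pM; rewrite ?(ltW eta0) //.
      by rewrite mulr_ge0 //; lra.
    by rewrite ler_pM2l //; lra.
  have h2 := ler_wpM2l (ltW a0) u1; have h3 := ler_wpM2l ab0 h1.
  have b3 : b <= 1 / 3 by lra.
  have h4 := ler_wpM2l (ltW T0) b3.
  lra.
Qed.

Section Perturbation.
Variables (R : realType) (d : nat) (phi : R -> R).
Hypothesis d_gt0 : (0 < d)%N.
Hypothesis phiA : class_A d phi.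
Hypothesis phi_incr : increasing01 phi.

Let phi_bd x : 0 < x < 1 -> 0 <= phi x <= d%:R. Proof. exact: phiA.1. Qed.

Let phi_le x y : 0 < x -> x <= y -> y < 1 -> phi x <= phi y.
Proof. by move=> x0 xy y1; apply: phi_incr => //; rewrite in_itv /=; lra. Qed.

Let phi_margin x y : 0 < x -> x <= y -> y < 1 -> (1 - y) * phi y <= (1 - x) * phi x.
Proof.
move=> x0; rewrite le_eqVlt => /predU1P[->//|xy] y1.
by have /andP[h _] := phiA.2 x y x0 xy y1; rewrite -subr_ge0.
Qed.

(** For increasing [phi] this bounds the oscillation on [[x0, 1)] by [eps], where the class
    inequalities give no uniform control. *)
Lemma near_sup eps : 0 < eps ->
  exists2 x0, 0 < x0 < 1 & forall x, 0 < x < 1 -> phi x <= phi x0 + eps.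
Proof.
move=> e0; pose A := [set phi x | x in [set x : R | 0 < x < 1]].
have half01 : 0 < (1 / 2 : R) < 1 by rewrite divr_gt0 //= ltr_pdivrMr // mul1r ltr1n.
have A_sup : has_sup A.
  split; first by exists (phi (1 / 2)), (1 / 2).
  by exists d%:R => _ [x hx <-]; have /andP[] := phi_bd hx.
have [_ [x0 hx0 <-] hlt] := sup_adherent e0 A_sup.
exists x0 => // x hx; have : phi x <= sup A.
  by apply: ub_le_sup; [exact: A_sup.2|exists x].
lra.
Qed.

Variables (v h : R -> R) (eta kappa s : R).
Hypothesis eta_bd : 0 < eta <= 1 / 100.
Hypothesis kappa_gt0 : 0 < kappa.
Hypothesis s_bd : 16 * kappa <= s <= 1.
Hypothesis v0 : v 0 = 0.
Hypothesis h0 : h 0 = 0.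
Hypothesis vh : forall x y, 0 <= x -> x <= y -> y <= 1 ->
  [/\ 0 <= v y - v x, v y - v x <= y - x, v y - v x <= eta * (y * (1 - x)) &
      `|h y - h x| <= v y - v x].

(** The factor [1 - s] makes room below [d]; the constant [10 kappa] protects the first inequality
    of the class, and the slope of [kappa x] the second. *)
Definition spiked (x : R) : R :=
  (1 - s) * phi (x - v x) + kappa * (10 + x) + 5 / 4 * kappa * h x.

Let v_bd x : 0 < x < 1 -> 0 <= v x <= eta * x.
Proof.
move=> /andP[x0 x1]; have [h1 _ h2 _] := vh (lexx 0) (ltW x0) (ltW x1).
by move: h1 h2; rewrite v0 !subr0 mulr1 => -> ->.
Qed.

Let h_bd x : 0 < x < 1 -> `|h x| <= eta.
Proof.
move=> hx; have /andP[x0 x1] := hx; have /andP[_ h1] := v_bd hx.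
have [_ _ _] := vh (lexx 0) (ltW x0) (ltW x1); rewrite v0 h0 !subr0 => h2.
have /andP[e0 e1] := eta_bd.
have : eta * x <= eta by rewrite ler_piMr // ltW.
lra.
Qed.

Let shift01 x : 0 < x < 1 -> 0 < x - v x < 1.
Proof.
move=> hx; have /andP[x0 x1] := hx; have /andP[h1 h2] := v_bd hx.
have /andP[e0 e1] := eta_bd.
have : eta * x <= 1 / 100 * x by rewrite ler_pM2r.
lra.
Qed.

Let shift_le x y : 0 < x -> x <= y -> y < 1 -> x - v x <= y - v y.
Proof. by move=> x0 xy y1; have [_ h1 _ _] := vh (ltW x0) xy (ltW y1); lra. Qed.

(** The class gives this with weights [1 - (x - v x)]. As [v] is nonnegative and increasing, the
    ratio of [1 - x] to this weight decreases, so the weights can be exchanged. *)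
Let shift_margin x y : 0 < x -> x <= y -> y < 1 ->
  (1 - y) * phi (y - v y) <= (1 - x) * phi (x - v x).
Proof.
move=> x0 xy y1.
have hx : 0 < x < 1 by lra.
have hy : 0 < y < 1 by lra.
have /andP[sx0 _] := shift01 hx; have /andP[_ sy1] := shift01 hy.
have := phi_margin sx0 (shift_le x0 xy y1) sy1.
have /andP[B0 _] := phi_bd (shift01 hy); have /andP[A0 _] := phi_bd (shift01 hx).
have /andP[vx0 _] := v_bd hx; have [vxy _ _ _] := vh (ltW x0) xy (ltW y1).
move: (phi (y - v y)) (phi (x - v x)) B0 A0 => B A B0 A0 AB.
have M0 : 0 < 1 - (x - v x) by lra.
rewrite -(ler_pM2r M0).
have h1 : (1 - y) * (1 - (x - v x)) <= (1 - x) * (1 - (y - v y)) by nra.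
have h2 := ler_wpM2l B0 h1.
have x1 : 0 <= 1 - x by lra.
have h3 := ler_wpM2l x1 AB.
lra.
Qed.

Lemma spiked_class : class_A d spiked.
Proof.
have d1 : 1 <= d%:R :> R by rewrite ler1n.
have /andP[eta0 eta1] := eta_bd; have /andP[s16 s1] := s_bd.
have eta_kappa : eta * kappa <= 1 / 100 * kappa by rewrite ler_pM2r.
have h_kappa x : 0 < x < 1 -> `|kappa * h x| <= 1 / 100 * kappa.
  move=> hx; rewrite normrM gtr0_norm // mulrC; apply: le_trans eta_kappa.
  by rewrite ler_pM2r // h_bd.
have base_bd x : 0 < x < 1 ->
    9 * kappa <= kappa * (10 + x) + 5 / 4 * kappa * h x <= 12 * kappa.
  move=> hx; have := h_kappa x hx; rewrite ler_norml; nra.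
have base_lip x y : 0 < x -> x <= y -> y < 1 ->
    kappa * (10 + y) + 5 / 4 * kappa * h y
    - (kappa * (10 + x) + 5 / 4 * kappa * h x) <= 9 / 4 * kappa * (y - x).
  move=> x0 xy y1; have [_ h1 _] := vh (ltW x0) xy (ltW y1).
  rewrite ler_norml => /andP[_ h2].
  have := ler_wpM2l (ltW kappa_gt0) (le_trans h2 h1); lra.
split=> [x hx|x y x0 xy y1].
  have := base_bd x hx; have := phi_bd (shift01 hx); rewrite /spiked.
  move: (phi _) => A hA hG.
  have hs : 0 <= (1 - s) * A <= (1 - s) * d%:R.
    by apply/andP; split; [apply: mulr_ge0|apply: ler_wpM2l]; lra.
  have : s <= s * d%:R by rewrite ler_peMr //; lra.
  lra.
have y0 : 0 < y by lra.
have hx : 0 < x < 1 by lra.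
have hy : 0 < y < 1 by lra.
apply/andP; split.
  have h1 := shift_margin x0 (ltW xy) y1.
  have s1' : 0 <= 1 - s by lra.
  have h2 := ler_wpM2l s1' h1.
  have h3 := base_lip x y x0 (ltW xy) y1; have h4 := base_bd x hx.
  (* The added terms grow by at most [9/4 kappa (y - x)], while the drop of the weight [1 - x] gains
     at least [9 kappa (y - x)]. *)
  have : (1 - y) * (kappa * (10 + y) + 5 / 4 * kappa * h y
      - (kappa * (10 + x) + 5 / 4 * kappa * h x)) <= 9 * kappa * (y - x).
    apply: (@le_trans _ _ ((1 - y) * (9 / 4 * kappa * (y - x)))).
      by rewrite ler_pM2l // subr_gt0.
    have : 0 <= kappa * (y - x) by rewrite mulr_ge0 ?ltW // subr_gt0.
    nra.
  have : 9 * kappa * (y - x)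
      <= (kappa * (10 + x) + 5 / 4 * kappa * h x) * (y - x).
    by rewrite ler_pM2r ?subr_gt0 //; case/andP: h4.
  have spikedE z : spiked z =
      (1 - s) * phi (z - v z) + (kappa * (10 + z) + 5 / 4 * kappa * h z).
    by rewrite /spiked addrA.
  rewrite !spikedE.
  move: (kappa * (10 + x) + _) (kappa * (10 + y) + _) => Gx Gy.
  move: (phi (x - v x)) (phi (y - v y)) h2 => A B.
  lra.
have mu01 : 0 < x / y < 1 by rewrite divr_gt0 //= ltr_pdivrMr // mul1r.
have xE : x = y * (x / y) by rewrite mulrC divfK // gt_eqF.
move: (x / y) mu01 xE => mu mu01 xE; have /andP[mu0 mu1] := mu01.
have x_mu : x <= mu by rewrite xE ger_pMl //; lra.
have P1 : phi (x - v x) <= phi (y - v y).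
  by apply: phi_le; [case/andP: (shift01 hx)|apply: shift_le => //; lra|
    case/andP: (shift01 hy)].
have P2 : phi (x - v x) <= phi (mu - v mu).
  by apply: phi_le; [case/andP: (shift01 hx)|exact: shift_le|
    case/andP: (shift01 mu01)].
(* As [1 - x = (1 - y) + (y - x)], the second inequality for [f] reads [(1 - y) (f x - f y) + (y -
   x) (f x - f mu) <= 0]. [P1] and [P2] settle the part from [phi]; this is the rest, an instance of
   [spike_slack] with [a = 1 - y] and [b = 1 - mu]. *)
have main : 5 / 4 * ((1 - y) * (h x - h y) + (y - x) * (h x - h mu))
    <= (1 - y) * (y - x) + (y - x) * (mu - x).
  have [_ a1 a2 a3] := vh (ltW x0) (ltW xy) (ltW y1).
  have [_ b1 b2 b3] := vh (ltW x0) x_mu (ltW mu1).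
  have p1 := le_trans a3 a1; have q1 := le_trans b3 b1.
  have p2 := le_trans a3 a2; have q2 := le_trans b3 b2.
  clear a1 a2 a3 b1 b2 b3.
  have mx : mu - x = mu * (1 - y) by rewrite xE; ring.
  have yx : y - x = y * (1 - mu) by rewrite xE; ring.
  have x1 : 1 - x = (1 - y) + (1 - mu) - (1 - y) * (1 - mu) by rewrite xE; ring.
  have abE : 1 - x <= (1 - y) + (1 - mu).
    by rewrite x1 lerBlDr lerDl mulr_ge0 // subr_ge0 ltW.
  have e0 := ltW eta0; rewrite distrC in p1 p2; rewrite distrC in q1 q2.
  have {}p1 := le_trans (ler_norm _) p1; have {}p2 := le_trans (ler_norm _) p2.
  have {}q1 := le_trans (ler_norm _) q1; have {}q2 := le_trans (ler_norm _) q2.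
  rewrite mx yx; rewrite mx in q1; rewrite yx in p1.
  have [ya yb ma mb] : [/\ 0 < 1 - y, 1 - y < 1, 0 < 1 - mu & 1 - mu < 1].
    by rewrite !subr_gt0 !gtrBl.
  have := @spike_slack R (1 - y) (1 - mu) (h x - h y) (h x - h mu) eta.
  rewrite !subKr; apply => //.
  - by apply: le_trans p2 _; rewrite ler_wpM2l // ler_wpM2l // ltW.
  - by apply: le_trans q2 _; rewrite ler_wpM2l // ler_wpM2l // ltW.
rewrite /spiked; have y1' : 0 <= 1 - y by lra.
have yx' : 0 <= y - x by lra.
have s1' : 0 <= 1 - s by lra.
have := ler_wpM2l s1' (lerD (ler_wpM2l y1' P1) (ler_wpM2l yx' P2)).
have := ler_wpM2l (ltW kappa_gt0) main.
move: (phi (x - v x)) (phi (y - v y)) (phi (mu - v mu)) => A B C.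
lra.
Qed.
Lemma spiked_close x0 eps : 0 < x0 < 1 -> s * d%:R <= eps -> 0 <= eps <= 1 ->
  100 * d%:R * eta <= eps * (1 - x0) ->
  (forall x, 0 < x < 1 -> phi x <= phi x0 + eps) ->
  forall x, 0 < x < 1 -> `|spiked x - phi x| <= 3 * eps.
Proof.
move=> /andP[x00 x01] s_eps /andP[eps0 eps1] eta_eps phi_sup x hx.
have d1 : 1 <= d%:R :> R by rewrite ler1n.
have /andP[x_gt0 x_lt1] := hx; have /andP[eta0 eta1] := eta_bd.
have /andP[v_ge0 v_le] := v_bd hx; have sx := shift01 hx; have /andP[sx0 sx1] := sx.
have /andP[s16 s1] := s_bd.
have lag0 : phi (x - v x) <= phi x by apply: phi_le => //; lra.
(* Beyond [x0] use the near-supremum. Before it, [x] stays away from 1, and [phi_margin] bounds the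
   lag by [d v x / (1 - x)]. *)
have lag : phi x - phi (x - v x) <= eps.
  have [far|near] := leP x0 (x - v x).
    by have := phi_sup x hx; have := phi_le x00 far sx1; lra.
  have eta_x0 : 100 * eta <= 1 - x0.
    apply: (@le_trans _ _ (100 * d%:R * eta)).
      by rewrite ler_pM2r // ler_peMr.
    by apply: le_trans eta_eps _; rewrite ler_piMl //; lra.
  have eta_x : eta * x <= eta by rewrite ler_piMr // ltW.
  have x_far : (1 - x0) / 2 <= 1 - x by lra.
  have x1' : 0 < 1 - x by lra.
  rewrite -(ler_pM2l x1'); have sxx : x - v x <= x by lra.
  have := phi_margin sx0 sxx x_lt1; have /andP[A0 Ad] := phi_bd sx.
  have : v x * phi (x - v x) <= eta * d%:R.
    by apply: ler_pM => //; lra.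
  have : eps * ((1 - x0) / 2) <= eps * (1 - x) by rewrite ler_wpM2l.
  have : 0 <= eps * (1 - x0) by rewrite mulr_ge0 //; lra.
  move: (phi _) (phi _) => A B; lra.
have /andP[A0 Ad] := phi_bd sx.
have h_kappa : `|kappa * h x| <= 1 / 100 * kappa.
  rewrite normrM gtr0_norm // mulrC ler_pM2r //.
  exact: le_trans (h_bd hx) _.
have kx : kappa * x <= kappa by rewrite ler_piMr // ltW.
have kx0 : 0 <= kappa * x by rewrite mulr_ge0 // ltW.
have s0 : 0 <= s by lra.
have sA : s * phi (x - v x) <= s * d%:R by rewrite ler_wpM2l.
have sA0 : 0 <= s * phi (x - v x) by rewrite mulr_ge0.
have s_le : s <= s * d%:R by rewrite ler_peMr.
move: h_kappa; rewrite ler_norml => /andP[hk1 hk2].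
rewrite /spiked ler_norml; move: (phi x) (phi (x - v x)) lag lag0 sA sA0 => A B *.
by apply/andP; split; lra.
Qed.

(** On the right [x - v x] is constant and [5/4 (1 - 2 eta)] exceeds 1 by more than 1/10, so [h]
    beats [kappa x]; on the left the term in [phi] only helps. *)
Lemma spiked_spike y rho : 0 < y < 1 -> 0 < rho ->
  (forall e, 0 < e -> e <= rho ->
    [/\ v (y + e) - v y = e, h (y + e) - h y <= - ((1 - 2 * eta) * e) &
        (1 - 2 * eta) * e <= h y - h (y - e)]) ->
  exists2 r, 0 < r & forall e, 0 < e -> e <= r ->
    spiked (y + e) - spiked y <= - (kappa / 10 * e) /\
    kappa / 10 * e <= spiked y - spiked (y - e).
Proof.
move=> /andP[y0 y1] rho0 hy; exists (Num.min rho (y / 2)).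
  by rewrite lt_min rho0 divr_gt0.
move=> e e0; rewrite le_min => /andP[e_rho e_y].
have [v_flat h_right h_left] := hy e e0 e_rho.
have /andP[eta0 eta1] := eta_bd; have /andP[s16 s1] := s_bd.
have ke0 : 0 < kappa * e by rewrite mulr_gt0.
have eta_ke : eta * (kappa * e) <= 1 / 100 * (kappa * e) by rewrite ler_pM2r.
have k0 := ltW kappa_gt0; split.
  have := ler_wpM2l k0 h_right; rewrite /spiked.
  have -> : y + e - v (y + e) = y - v y by lra.
  lra.
have := ler_wpM2l k0 h_left; rewrite /spiked.
have ye0 : 0 < y - e by lra.
have yey : y - e <= y by lra.
have hye : 0 < y - e < 1 by apply/andP; split; lra.
have hy' : 0 < y < 1 by apply/andP.
have mono : phi (y - e - v (y - e)) <= phi (y - v y).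
  apply: phi_le; [by case/andP: (shift01 hye)|exact: shift_le|].
  by case/andP: (shift01 hy').
have s1' : 0 <= 1 - s by lra.
have := ler_wpM2l s1' mono.
move: (phi _) (phi _) => A B; lra.
Qed.

End Perturbation.

(** * Signs of Dini derivatives from one-sided linear bounds *)

Section Dini.
Variable R : realType.

Lemma dini_upper_right_lt0 (f : R -> R) x c r : 0 < c -> 0 < r ->
  (forall e, 0 < e -> e <= r -> f (x + e) - f x <= - (c * e)) ->
  (dini_upper_right f x < 0)%E.
Proof.
move=> c0 r0 hf; apply: (@le_lt_trans _ _ (- c)%:E); last by rewrite lte_fin oppr_lt0.
rewrite /dini_upper_right limf_esupE; apply: ge_ereal_inf; eexists.
  exists [set e | 0 < e < r]; last reflexivity.
  near=> e => /=; apply/andP; split; near: e.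
    exact: nbhs_right_gt.
  exact: nbhs_right_lt.
apply: ge_ereal_sup => _ [e /= /andP[e0 er] <-].
by rewrite lee_fin ler_pdivrMr // mulNr hf // ltW.
Unshelve. all: by end_near. Qed.

(** Every neighbourhood in the infimum defining the limsup contains some [e < r], hence a quotient
    at least [c]. *)
Lemma dini_upper_left_gt0 (f : R -> R) x c r : 0 < c -> 0 < r ->
  (forall e, 0 < e -> e <= r -> c * e <= f x - f (x - e)) ->
  (0 < dini_upper_left f x)%E.
Proof.
move=> c0 r0 hf; apply: (@lt_le_trans _ _ c%:E); first by rewrite lte_fin.
rewrite /dini_upper_left limf_esupE; apply/ereal_infP => _ [V hV <-].
have /filter_ex[e [[e0 er] Ve]] :
    \forall e \near (0 : R)^'+, (0 < e /\ e < r) /\ V e.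
  near=> e; split; last by near: e.
  by split; near: e; [exact: nbhs_right_gt|exact: nbhs_right_lt].
apply: le_ereal_sup_tmp; exists ((f x - f (x - e)) / e)%:E; first by exists e.
by rewrite lee_fin ler_pdivlMr // hf // ltW.
Unshelve. all: by end_near. Qed.

End Dini.

(** * Choice of the constants and conclusion *)

Theorem theorem4p6 (R : realType) (d : nat) (phi : R -> R) (L : set R) :
  (0 < d)%N ->
  class_A d phi ->
  increasing01 phi ->
  countable L ->
  L `<=` `]0, 1[%classic ->
  forall eps : R, 0 < eps ->
  exists (F : set 'rV[R]_d) (f : R -> R),
    [/\ forall theta : R, 0 < theta < 1 -> assouad_spectrum F theta = (f theta)%:E,
        (supnorm01 (fun theta => (f theta - phi theta)%R) <= eps%:E)%E &
        forall lambda : R, L lambda ->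
          (0 < dini_upper_left f lambda)%E /\ (dini_upper_right f lambda < 0)%E].
Proof.
move=> d_gt0 phiA phi_incr L_count L01 eps eps0.
have [lam [lam_inj lam01 lamL]] := countable_sequence L_count L01.
(* [spiked_close] loses three times its tolerance; the cap 1 ensures [s <= 1]. *)
pose eps1 := Num.min (eps / 3) 1.
have eps1_gt0 : 0 < eps1 by rewrite lt_min divr_gt0 //=.
have eps1_le1 : eps1 <= 1 by rewrite ge_min lexx orbT.
have eps1_le : 3 * eps1 <= eps.
  by rewrite -ler_pdivlMl // mulrC ge_min lexx.
have dR : 1 <= d%:R :> R by rewrite ler1n.
have dR0 : 0 < d%:R :> R by rewrite ltr0n.
have [x0 x001 phi_sup] := near_sup phiA eps1_gt0.
have /andP[x00 x01] := x001.
(* Small relative to [1 - x0], so that the lag before [x0] is within tolerance. *)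
pose eta := eps1 * (1 - x0) / (100 * d%:R).
have eta0 : 0 < eta by rewrite divr_gt0 ?mulr_gt0 // subr_gt0.
have etaE : 100 * d%:R * eta = eps1 * (1 - x0).
  by rewrite mulrC divfK // mulf_neq0 ?gt_eqF.
have eta1 : eta <= 1 / 100.
  rewrite ler_pdivrMr ?mulr_gt0 // mulrA divfK ?pnatr_eq0 // mul1r.
  by apply: le_trans dR; rewrite mulr_ile1 //; lra.
have eta01 : 0 < eta <= 1 by rewrite eta0 /=; lra.
have eta_bd : 0 < eta <= 1 / 100 by rewrite eta0.
have [v [h [v0 h0 vh spikes]]] := spike_pair lam_inj lam01 eta01.
pose s := eps1 / d%:R.
have s0 : 0 < s by rewrite divr_gt0.
have sd : s * d%:R = eps1 by rewrite divfK // gt_eqF.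
have s1 : s <= 1 by rewrite ler_pdivrMr // mul1r; exact: le_trans eps1_le1 dR.
pose kappa := s / 16.
have kappa0 : 0 < kappa by rewrite divr_gt0.
have s_bd : 16 * kappa <= s <= 1 by rewrite mulrC divfK ?pnatr_eq0 // lexx.
pose f := spiked phi v h kappa s.
have fA : class_A d f by exact: spiked_class eta_bd kappa0 s_bd v0 h0 vh.
exists (@moran R d f), f; split.
- by move=> theta; exact: moran_spectrum.
- apply: ge_ereal_sup => _ [x hx <-]; rewrite /= in_itv /= in hx.
  rewrite lee_fin; apply: le_trans eps1_le.
  apply: (spiked_close d_gt0 phiA phi_incr eta_bd kappa0 s_bd v0 h0 vh x001) => //.
  + by rewrite sd.
  + by rewrite ltW.
  + by rewrite etaE.
- move=> lambda /lamL[n <-]; have [rho rho0 hrho] := spikes n.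
  have [r r0 hr] := spiked_spike phi_incr eta_bd kappa0 s_bd v0 vh (lam01 n) rho0 hrho.
  have k0 : 0 < kappa / 10 by rewrite divr_gt0.
  split.
  + by apply: (dini_upper_left_gt0 k0 r0) => e e0 er; case: (hr e e0 er).
  + by apply: (dini_upper_right_lt0 k0 r0) => e e0 er; case: (hr e e0 er).
Qed.
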